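(* Fix $q\in(0,1)$, $\alpha>0$, $\beta<0$. For $N\ge1$ let $M_N$ be the probability measure on the set $\Omega_N$ of $N$-point subsets $\{x_1,\dots,x_N\}$ of $\Delta_{q,\alpha,\beta}$ given by $$M_N(\{x_1,\dots,x_N\})=\mathrm{const}_N\cdot\prod_{i=1}^N|x_i|\,(\alpha x_i;q)_\infty(\beta x_i;q)_\infty\cdot\prod_{1\le i<j\le N}(x_i-x_j)^2,$$ where $\mathrm{const}_N$ is the normalizing constant (this is the case $\gamma=\delta=0$ of the weight $|x|\frac{(\alpha x;q)_\infty(\beta x;q)_\infty}{(\gamma q^{1-N}x;q)_\infty(\delta q^{1-N}x;q)_\infty}$). Regard $M_N$ as a measure on $\Omega\supset\Omega_N$. Then, as $N\to\infty$, $M_N$ converges weakly to the delta measure at the configuration $\Delta_{q,\alpha,\beta}\in\Omega$ (the whole lattice).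
   Context: $\Delta_{q,\alpha,\beta}:=\{\beta^{-1}q,\beta^{-1}q^2,\dots\}\cup\{\alpha^{-1}q,\alpha^{-1}q^2,\dots\}\subset\mathbb{R}\setminus\{0\}$. $\Omega$ is the set of all subsets of $\Delta_{q,\alpha,\beta}$, identified with $\{0,1\}^{\Delta_{q,\alpha,\beta}}$ with the product topology (compact). $(z;q)_\infty=\prod_{i\ge1}(1-zq^{i-1})$. *)

(* Defs.v *)
From HB Require Import structures.
From mathcomp Require Import all_boot all_order all_algebra finmap.
From mathcomp Require Import all_classical all_reals all_analysis.
Set Implicit Arguments.
Unset Strict Implicit.
Unset Printing Implicit Defensive.
Import Order.TTheory GRing.Theory Num.Theory numFieldNormedType.Exports.
Local Open Scope classical_set_scope.
Local Open Scope ring_scope.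

Definition borel (T : ptopologicalType) := g_sigma_algebraType (@open T).

Definition weakly_converges (R : realType) (T : ptopologicalType)
    (P : nat -> probability (borel T) R) (Q : probability (borel T) R) : Prop :=
  forall f : T -> R, continuous f -> [bounded f x | x in [set: T]] ->
    (\int[P n]_x (f x)%:E)%E @[n --> \oo] --> (\int[Q]_x (f x)%:E)%E.

Definition qPochhammer (R : realType) (z q : R) : R :=
  limn (fun n => \prod_(i < n) (1 - z * q ^+ i)).

Definition lattice (R : realType) (q a b : R) : set R :=
  [set b^-1 * q ^+ k.+1 | k in [set: nat]] `|`
  [set a^-1 * q ^+ k.+1 | k in [set: nat]].

(* A subset of the lattice is encoded by its indicator function. The pointed
   structure is only there to obtain a ptopologicalType. *)
Definition configuration (R : realType) (q a b : R) : Type :=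
  {ptws lattice q a b -> bool}.

HB.instance Definition _ (R : realType) (q a b : R) :=
  Topological.copy (configuration q a b) {ptws lattice q a b -> bool}.

HB.instance Definition _ (R : realType) (q a b : R) :=
  isPointed.Build (configuration q a b) (fun=> false).

Definition config_of (R : realType) (q a b : R) (X : {fset lattice q a b}) :
  configuration q a b := fun x => x \in X.

Definition full_config (R : realType) (q a b : R) : configuration q a b :=
  fun=> true.
Arguments full_config {R} q a b.

(* Each unordered pair of points contributes once: the Vandermonde product is
   indexed by the pairs x < y, which matches i < j for the increasing
   enumeration of X. *)
Definition weight (R : realType) (q a b : R) (X : {fset lattice q a b}) : R :=
  (\prod_(x <- X) (`|val x| * qPochhammer (a * val x) q
                            * qPochhammer (b * val x) q)) *
  \prod_(x <- X) \prod_(y <- X | (val x < val y)%R) (val x - val y) ^+ 2.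

Definition partition_function (R : realType) (q a b : R) (N : nat) : \bar R :=
  \esum_(X in [set X : {fset lattice q a b} | #|` X| = N]) (weight X)%:E.

Section qPochhammer_bounds.
Context (R : realType) (q : R).
Hypothesis hq : 0 < q < 1.

Let q0 : 0 < q. Proof. by case/andP: hq. Qed.
Let q1 : q < 1. Proof. by case/andP: hq. Qed.

Lemma geometric_sum_le (c : R) n : 0 <= c ->
  \sum_(i < n) c * q ^+ i <= c / (1 - q).
Proof.
move=> c0; have := @geometric_le_lim R n c q c0 q0.
by rewrite /series /= big_mkord ger0_norm ?(ltW q0)//; apply.
Qed.

Lemma qPochhammer_le0 (z : R) : z <= 0 ->
  1 <= qPochhammer z q <= expR (- z / (1 - q)).
Proof.
move=> z0; set u := fun n => \prod_(i < n) (1 - z * q ^+ i).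
have f1 i : 1 <= 1 - z * q ^+ i.
  by rewrite lerDl -mulNr mulr_ge0 ?oppr_ge0 ?exprn_ge0// ltW.
have u1 n : 1 <= u n.
  apply: (big_ind (fun x => 1 <= x)) => // x y x1 y1.
  by rewrite -[leLHS]mulr1; apply: ler_pM; rewrite ?ler01.
have un n : u n <= expR (- z / (1 - q)).
  apply: (@le_trans _ _ (expR (\sum_(i < n) (- z) * q ^+ i))).
    rewrite expR_sum; apply: ler_prod => i _.
    by rewrite (le_trans ler01 (f1 i))/= -mulNr expR_ge1Dx.
  by rewrite ler_expR geometric_sum_le// oppr_ge0.
have ndu : nondecreasing_seq u.
  apply/nondecreasing_seqP => n; rewrite /u big_ord_recr /= ler_peMr//.
  exact: le_trans (u1 n).
have cu : cvgn u.
  apply: nondecreasing_is_cvgn => //; exists (expR (- z / (1 - q))).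
  by move=> _ [n _ <-].
by rewrite /qPochhammer -/u limr_ge ?limr_le//; exact: nearW.
Qed.

Lemma qPochhammer_01 (z : R) : 0 <= z < 1 -> 0 < qPochhammer z q <= 1.
Proof.
move=> /andP[z0 z1]; set u := fun n => \prod_(i < n) (1 - z * q ^+ i).
have z'0 : 0 < 1 - z by rewrite subr_gt0.
have zq i : z * q ^+ i <= z by rewrite ler_piMr// exprn_ile1// ltW.
have zq0 i : 0 <= z * q ^+ i by rewrite mulr_ge0 ?exprn_ge0// ltW.
have f0 i : 0 < 1 - z * q ^+ i by rewrite subr_gt0 (le_lt_trans (zq i)).
have f1 i : 1 - z * q ^+ i <= 1 by rewrite gerBl.
have u0 n : 0 < u n by apply: prodr_gt0.
set C := z / (1 - z) / (1 - q).
have uC n : expR (- C) <= u n.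
  apply: (@le_trans _ _ (expR (\sum_(i < n) - (z / (1 - z) * q ^+ i)))).
    by rewrite sumrN ler_expR lerN2 geometric_sum_le// divr_ge0// ltW.
  rewrite expR_sum; apply: ler_prod => i _; rewrite expR_ge0/= expRN.
  rewrite -[leRHS]invrK lef_pV2 ?posrE ?expR_gt0 ?invr_gt0//.
  apply: (le_trans _ (expR_ge1Dx _)).
  have -> : (1 - z * q ^+ i)^-1 = 1 + (z * q ^+ i) / (1 - z * q ^+ i).
    have n0 : 1 - z * q ^+ i != 0 by rewrite gt_eqF.
    by apply: (mulIf n0); rewrite mulVf// mulrDl mul1r divfK// subrK.
  rewrite lerD2l [leRHS]mulrAC ler_wpM2l// lef_pV2 ?posrE//.
  by rewrite lerD2l lerN2.
have u1 n : u n <= 1.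
  by rewrite /u prodr_ile1// => i _; rewrite f1 ltW.
have niu : nonincreasing_seq u.
  apply/nonincreasing_seqP => n; rewrite /u big_ord_recr /= ler_piMr//.
  exact: (ltW (u0 n)).
have cu : cvgn u.
  apply: nonincreasing_is_cvgn => //; exists 0 => _ [n _ <-].
  exact: (ltW (u0 n)).
rewrite /qPochhammer -/u limr_le ?andbT//; last exact: nearW.
rewrite (lt_le_trans (expR_gt0 (- C)))// limr_ge//; exact: nearW.
Qed.

End qPochhammer_bounds.

Section summability.
Context (R : realType) (q a b : R).
Hypotheses (hq : 0 < q < 1) (ha : 0 < a) (hb : b < 0).
Local Notation L := (lattice q a b).

Let q0 : 0 < q. Proof. by case/andP: hq. Qed.
Let q1 : q < 1. Proof. by case/andP: hq. Qed.

Let dec (p : bool * nat) : R := (if p.1 then b^-1 else a^-1) * q ^+ p.2.+1.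

Let latticeP (x : L) : {p | val x = dec p}.
Proof.
apply: cid; case: x => x /=; rewrite inE => -[] [k _ <-].
  by exists (true, k).
by exists (false, k).
Qed.

Let qS k : 0 < q ^+ k.+1 < 1.
Proof. by rewrite exprn_gt0//= exprn_ilt1// ltW. Qed.

Lemma factor_bounds : exists2 K : R, 0 < K & forall x : L,
  0 < `|val x| * qPochhammer (a * val x) q * qPochhammer (b * val x) q
    <= K * `|val x|.
Proof.
pose K1 := expR (- (a / b) / (1 - q)); pose K2 := expR (- (b / a) / (1 - q)).
have K10 : 0 < K1 by exact: expR_gt0.
have K20 : 0 < K2 by exact: expR_gt0.
have ab0 : 0 < - (a / b) by rewrite oppr_gt0 pmulr_rlt0// invr_lt0.
have ba0 : 0 < - (b / a) by rewrite oppr_gt0 pmulr_llt0 ?invr_gt0.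
have q'0 : 0 < (1 - q)^-1 by rewrite invr_gt0 subr_gt0.
exists (K1 + K2); first exact: addr_gt0.
move=> x; have [[[] k] ->] := latticeP x; rewrite /dec /=;
  have /andP[k0 k1] := qS k; set t := q ^+ k.+1 in k0 k1 *.
- have bt : b * (b^-1 * t) = t by rewrite mulVKf// lt_eqF.
  have at' : a * (b^-1 * t) = - (- (a / b) * t) by rewrite mulNr opprK mulrA.
  have t0 : 0 <= t < 1 by rewrite k1 ltW.
  have at0 : a * (b^-1 * t) <= 0 by rewrite at' oppr_le0 mulr_ge0// ltW.
  have /andP[p1 p2] := qPochhammer_le0 hq at0.
  have /andP[r1 r2] := qPochhammer_01 hq t0.
  have n0 : 0 < `|b^-1 * t| by rewrite normr_gt0 mulf_neq0 ?invr_eq0 ?(lt_eqF hb) ?(gt_eqF k0).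
  rewrite bt !mulr_gt0 ?(lt_le_trans ltr01 p1)//=.
  rewrite -mulrA mulrC ler_pM2r// -[leRHS]mulr1.
  apply: ler_pM; rewrite ?(ltW r1) ?(le_trans ler01 p1)//.
  apply: (le_trans p2); rewrite ler_wpDr ?(ltW K20)// ler_expR at' opprK.
  by rewrite ler_wpM2r ?(ltW q'0)// ler_piMr// ltW.
- have bt : a * (a^-1 * t) = t by rewrite mulVKf// gt_eqF.
  have at' : b * (a^-1 * t) = - (- (b / a) * t) by rewrite mulNr opprK mulrA.
  have t0 : 0 <= t < 1 by rewrite k1 ltW.
  have at0 : b * (a^-1 * t) <= 0 by rewrite at' oppr_le0 mulr_ge0// ltW.
  have /andP[p1 p2] := qPochhammer_le0 hq at0.
  have /andP[r1 r2] := qPochhammer_01 hq t0.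
  have n0 : 0 < `|a^-1 * t| by rewrite normr_gt0 mulf_neq0 ?invr_eq0 ?(gt_eqF ha) ?(gt_eqF k0).
  rewrite bt !mulr_gt0 ?(lt_le_trans ltr01 p1)//=.
  rewrite -mulrA mulrC ler_pM2r// mulrC -[leRHS]mulr1.
  apply: ler_pM; rewrite ?(ltW r1) ?(le_trans ler01 p1)//.
  apply: (le_trans p2); rewrite ler_wpDl ?(ltW K10)// ler_expR at' opprK.
  by rewrite ler_wpM2r ?(ltW q'0)// ler_piMr// ltW.
Qed.

Lemma weight_gt0 (X : {fset L}) : 0 < weight X.
Proof.
have [K K0 HK] := factor_bounds; rewrite /weight mulr_gt0 ?prodr_gt0//.
  by move=> x _; case/andP: (HK x).
move=> x _; apply: prodr_gt0 => y xy; rewrite exprn_even_gt0//=.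
by rewrite subr_eq0 lt_eqF.
Qed.

Let norm_bound (x : L) : `|val x| <= `|a^-1| + `|b^-1|.
Proof.
have [[[] k] ->] := latticeP x; rewrite /dec /= normrM;
  have /andP[k0 k1] := qS k; rewrite (gtr0_norm k0).
  by rewrite ler_wpDl// ler_piMr// ltW.
by rewrite ler_wpDr// ler_piMr// ltW.
Qed.

Lemma weight_le N : exists2 C : R, 0 < C & forall X : {fset L},
  #|` X| = N -> weight X <= C * \prod_(x <- X) `|val x|.
Proof.
have [K K0 HK] := factor_bounds.
pose B : R := 1 + (`|a^-1| + `|b^-1| + (`|a^-1| + `|b^-1|)) ^+ 2.
have B1 : 1 <= B by rewrite lerDl sqr_ge0.
have B0 : 0 < B by rewrite (lt_le_trans ltr01).
exists (K ^+ N * (B ^+ N) ^+ N); first by rewrite mulr_gt0 ?exprn_gt0.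
move=> X XN; rewrite /weight mulrAC ler_pM//.
- by apply: prodr_ge0 => x _; case/andP: (HK x) => /ltW.
- by apply: prodr_ge0 => x _; apply: prodr_ge0 => y _; rewrite sqr_ge0.
- have -> : K ^+ N * (\prod_(x <- X) `|val x|) = \prod_(x <- X) (K * `|val x|).
    by rewrite big_split /= big_const_seq count_predT iter_mulr_1 XN.
  by apply: ler_prod => x _; case/andP: (HK x) => /ltW -> ->.
- have -> : (B ^+ N) ^+ N = \prod_(x <- X) (B ^+ N).
    by rewrite big_const_seq count_predT iter_mulr_1 XN.
  apply: ler_prod => x _; apply/andP; split.
    by apply: prodr_ge0 => y _; rewrite sqr_ge0.
  have -> : B ^+ N = \prod_(y <- X) B.
    by rewrite big_const_seq count_predT iter_mulr_1 XN.
  rewrite big_mkcond; apply: ler_prod => y _; case: ifP => _; last first.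
    by rewrite ler01.
  rewrite sqr_ge0 /= /B ler_wpDl// -real_normK ?num_real//.
  apply: lerXn2r; rewrite ?nnegrE ?addr_ge0//.
  apply: (le_trans (ler_normB _ _)); apply: lerD; exact: norm_bound.
Qed.

Let sum_norm_le (s : seq L) : uniq s ->
  \sum_(x <- s) `|val x| <= (`|b^-1| + `|a^-1|) / (1 - q).
Proof.
move=> us; pose code x := sval (latticeP x).
have codeK x : val x = dec (code x) by rewrite /code; case: latticeP.
have code_inj : injective code.
  by move=> x y xy; apply: val_inj; rewrite !codeK xy.
pose m := (\max_(x <- s) (code x).2).+1.
have -> : \sum_(x <- s) `|val x| = \sum_(p <- map code s) `|dec p|.
  by rewrite big_map; apply: eq_bigr => x _; rewrite codeK.
pose t := [seq (c, k) | c <- [:: true; false], k <- iota 0 m].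
apply: (@le_trans _ _ (\sum_(p <- t) `|dec p|)).
  have ut : uniq t.
    apply: allpairs_uniq => //; first exact: iota_uniq.
    by move=> [? ?] [? ?] _ _ [-> ->].
  have us' : uniq (map code s) by rewrite map_inj_uniq.
  have st : {subset map code s <= t}.
    move=> p /mapP[x xs ->]; rewrite (surjective_pairing (code x)).
    apply: allpairs_f; first by case: (code x).1; rewrite !inE.
    rewrite mem_iota add0n /= ltnS /m.
    by rewrite (big_rem x)//= leq_maxl.
  rewrite [leRHS](bigID (mem (map code s))) /= -[leLHS]addr0 lerD//.
    rewrite -[leRHS]big_filter le_eqVlt; apply/orP; left; apply/eqP.
    apply: perm_big; apply: uniq_perm => //; first exact: filter_uniq.
    by move=> p; rewrite mem_filter; case: (boolP (p \in _)) => // /st ->.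
  by apply: sumr_ge0 => p _.
have H (c : R) : \sum_(k <- iota 0 m) `|c * q ^+ k.+1| <= `|c| / (1 - q).
  rewrite -[iota 0 m]/(index_iota 0 m) big_mkord.
  apply: le_trans (geometric_sum_le hq m (normr_ge0 c)).
  apply: ler_sum => k _; rewrite normrM ler_wpM2l// gtr0_norm ?exprn_gt0//.
  by rewrite exprS ler_piMl ?exprn_ge0 ?ltW.
rewrite /t; clear t; clearbody m.
rewrite big_allpairs !big_cons big_nil /= addr0 mulrDl.
by apply: lerD; exact: H.
Qed.

Let sum_prod_le (F : L -> R) (s : seq L) (A : seq {fset L}) :
  (forall x, 0 <= F x) -> uniq A ->
  (forall X, X \in A -> {subset X <= s}) ->
  \sum_(X <- A) \prod_(x <- X) F x <= \prod_(x <- s) (1 + F x).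
Proof.
move=> F0; elim: s A => [|y s IH] A uA sA.
  rewrite big_nil.
  have {sA} A0 X : X \in A -> X = fset0.
    by move=> /sA sX; apply/fsetP => x; rewrite inE; apply/negP => /sX.
  case: A uA A0 => [|X A]; first by rewrite big_nil.
  case: A => [|Y A] uA A0.
    by rewrite big_seq1 (A0 X) ?inE// big_seq_fset0.
  have eX : X = fset0 by apply: A0; rewrite mem_head.
  have eY : Y = fset0 by apply: A0; rewrite in_cons mem_head orbT.
  by move: uA; rewrite eX eY cons_uniq mem_head.
rewrite big_cons (bigID (fun X : {fset L} => y \in X)) /= addrC mulrDl mul1r.
have sub (X : {fset L}) : {subset X <= y :: s} -> y \notin X ->
    {subset X <= s}.
  move=> sX yX x xX; have := sX _ xX; rewrite inE => /orP[/eqP xy|//].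
  by rewrite -xy xX in yX.
rewrite lerD//.
  rewrite -big_filter; apply: IH; first exact: filter_uniq.
  by move=> X; rewrite mem_filter => /andP[yX /sA sX]; exact: sub.
rewrite -big_filter.
set A' : seq {fset L} := [seq X <- A | y \in X].
have yA' (X : {fset L}) : X \in A' -> y \in X by rewrite mem_filter => /andP[].
rewrite (eq_big_seq (fun X : {fset L} =>
    F y * \prod_(x <- (X `\ y)%fset) F x)); last first.
  by move=> X /yA' yX; rewrite (big_fsetD1 y).
rewrite -big_distrr /= ler_wpM2l//.
rewrite -(big_map (fun X : {fset L} => X `\ y)%fset xpredT
   (fun X : {fset L} => \prod_(x <- X) F x)).
apply: IH.
  rewrite map_inj_in_uniq ?filter_uniq// => X Y /yA' yX /yA' yY XY.
  by rewrite -(fsetD1K yX) XY fsetD1K.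
move=> _ /mapP[X XA' ->]; apply: sub; last by rewrite !inE eqxx.
move=> x; rewrite !inE => /andP[_ xX].
by move: XA'; rewrite mem_filter => /andP[_ /sA /(_ _ xX)]; rewrite inE.
Qed.

Lemma partition_function_fin_num N : partition_function q a b N \is a fin_num.
Proof.
have [C C0 HC] := weight_le N.
pose M := (`|b^-1| + `|a^-1|) / (1 - q).
rewrite ge0_fin_numE; last first.
  by apply: esum_ge0 => X _; rewrite lee_fin ltW// weight_gt0.
apply: (@le_lt_trans _ _ (C * expR M)%:E); last by rewrite ltry.
apply: ge_ereal_sup => _ [A [finA AN] <-].
rewrite fsbig_finite//= sumEFin lee_fin.
set A' : seq {fset L} := fset_set A.
have A'E X : X \in A' -> #|` X| = N by rewrite in_fset_set// inE => /AN.
apply: (@le_trans _ _ (\sum_(X <- A') C * \prod_(x <- X) `|val x|)).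
  by rewrite big_seq [leRHS]big_seq ler_sum// => X /A'E; exact: HC.
rewrite -big_distrr /= ler_pM2l//.
pose U : {fset L} := (\bigcup_(X <- A') X)%fset.
apply: (@le_trans _ _ (\prod_(x <- U) (1 + `|val x|))).
  apply: sum_prod_le => //; first exact: fset_uniq.
  move=> X XA x xX; apply/bigfcupP; exists X => //.
  by rewrite XA.
apply: (@le_trans _ _ (expR (\sum_(x <- U) `|val x|))).
  rewrite expR_sum; apply: ler_prod => x _.
  by rewrite expR_ge1Dx addr_ge0.
by rewrite ler_expR; apply: sum_norm_le; exact: fset_uniq.
Qed.

Lemma partition_function_gt0 N : (0 < partition_function q a b N)%E.
Proof.
have ptP k : a^-1 * q ^+ k.+1 \in L by rewrite inE; right; exists k.
pose pt k : L := SigSub (ptP k).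
have pt_inj : injective pt.
  move=> i j /(congr1 val) /= /mulfI; rewrite invr_eq0 gt_eqF// => /(_ isT).
  by move=> /(ieexprIn q0); rewrite lt_eqF// => /(_ isT) [].
pose X : {fset L} := [fset pt i | i in iota 0 N]%fset.
have XN : #|` X| = N.
  by rewrite card_imfset//= undup_id ?iota_uniq// size_iota.
apply: (@lt_le_trans _ _ (weight X)%:E); first by rewrite lte_fin weight_gt0.
apply: esum_ge; exists [set X]; last by rewrite fsbig_set1.
by split; [exact: finite_set1|move=> _ ->].
Qed.

End summability.

(* The law of config_of X for X a random N-point subset; the
   inequalities are carried along because they are what makes it a probability
   measure. *)
Definition ensemble (R : realType) (q a b : R) (hq : 0 < q < 1) (ha : 0 < a)
    (hb : b < 0) (N : nat) : set (borel (configuration q a b)) -> \bar R :=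
  fun A => (((fine (partition_function q a b N))^-1)%:E *
    \esum_(X in [set X : {fset lattice q a b} |
                   #|` X| = N /\ A (config_of X)]) (weight X)%:E)%E.

Section ensemble_probability.
Context (R : realType) (q a b : R).
Hypotheses (hq : 0 < q < 1) (ha : 0 < a) (hb : b < 0).
Variable N : nat.
Local Notation M := (ensemble hq ha hb N).

Let w_ge0 (X : {fset lattice q a b}) : (0 <= (weight X)%:E)%E.
Proof. by rewrite lee_fin ltW// weight_gt0. Qed.

Let c_ge0 : (0 <= ((fine (partition_function q a b N))^-1)%:E)%E.
Proof.
by rewrite lee_fin invr_ge0 fine_ge0// ltW// partition_function_gt0.
Qed.

Let ensemble0 : M set0 = 0%E.
Proof.
rewrite /ensemble (_ : [set X | _] = set0) ?esum_set0 ?mule0//.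
by apply/seteqP; split => X // [].
Qed.

Let ensemble_ge0 A : (0 <= M A)%E.
Proof. by rewrite /ensemble mule_ge0// esum_ge0. Qed.

Let ensemble_sigma_additive : semi_sigma_additive M.
Proof.
move=> F mF tF mUF.
have -> : M (\bigcup_n F n) = (\sum_(0 <= i <oo) M (F i))%E.
  rewrite /ensemble nneseriesZl; last by move=> i _; exact: esum_ge0.
  rewrite -nneseries_sum_bigcup//.
    congr (_ * esum _ _)%E; apply/seteqP; split => X.
      by move=> [XN [n _ FX]]; exists n.
    by move=> [n _ [XN FX]]; split => //; exists n.
  move=> i j _ _ [X [[_ Xi] [_ Xj]]]; apply: (tF i j) => //.
  by exists (config_of X).
by apply: is_cvg_nneseries => n _ _; exact: ensemble_ge0.
Qed.

HB.instance Definition _ := isMeasure.Build _ _ _ M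
  ensemble0 ensemble_ge0 ensemble_sigma_additive.

Let ensemble_setT : M [set: _] = 1%E.
Proof.
have pf := partition_function_fin_num hq ha hb N.
have p0 := partition_function_gt0 hq ha hb N.
rewrite /ensemble (_ : [set X | _] = [set X | #|` X| = N]); last first.
  by apply/seteqP; split => X // [].
rewrite -[esum _ _]/(partition_function q a b N) -{2}(fineK pf) -EFinM mulVf//.
by rewrite gt_eqF// fine_gt0// p0 -ge0_fin_numE// ltW.
Qed.

HB.instance Definition _ := Measure_isProbability.Build _ _ _ M ensemble_setT.

End ensemble_probability.

(* Main.v *)
(* Fix a lattice point p. If an N-point configuration X misses p, let y be a
   point of X of least absolute value and replace it by p. The weight of X is at
   most C |y| times that of the new configuration X', with C independent of N
   and X: if |x| <= |p|/3 then |y - x| <= 2|x| <= |p - x|, so that only the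
   finitely many other lattice points x can make the Vandermonde product
   decrease. The pair (X', y) determines X, and y is outside any prescribed
   finite set once N is large; as the sum of |y| over the lattice converges, the
   probability of missing p tends to 0. *)
Require Import Defs.
From HB Require Import structures.
From mathcomp Require Import all_boot all_order all_algebra finmap.
From mathcomp Require Import all_classical all_reals all_analysis.
From mathcomp Require Import measurable_realfun ring lra.
Set Implicit Arguments.
Unset Strict Implicit.
Unset Printing Implicit Defensive.
Import Order.TTheory GRing.Theory Num.Theory numFieldNormedType.Exports.
Local Open Scope classical_set_scope.
Local Open Scope ring_scope.

(** * Summability of [|x|] over the lattice *)

Lemma ler_sum_subseq (R : numDomainType) (I : eqType) (s t : seq I)
    (F : I -> R) :
  (forall i, 0 <= F i) -> uniq s -> {subset s <= t} ->
  \sum_(i <- s) F i <= \sum_(i <- t) F i.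
Proof.
move=> F0 us st; apply: (@le_trans _ _ (\sum_(i <- undup t) F i)).
  rewrite [leRHS](bigID (mem s)) /= -[leLHS]addr0 lerD ?sumr_ge0//.
  rewrite -[leRHS]big_filter le_eqVlt; apply/orP; left; apply/eqP.
  apply: perm_big; apply: uniq_perm; rewrite ?filter_uniq ?undup_uniq// => i.
  by rewrite mem_filter mem_undup; case: (boolP (i \in s)) => //= /st ->.
elim: t {st} => //= i t IH; rewrite big_cons; case: ifP => _; last first.
  by rewrite big_cons lerD2l.
by apply: (le_trans IH); rewrite lerDr.
Qed.

Section lattice_sums.
Context (R : realType) (q a b : R).
Hypothesis hq : 0 < q < 1.
Local Notation L := (lattice q a b).

(** A finite list of lattice points lies in two truncated geometric progressions, whose sums have
    bounds independent of the truncation. *)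
Lemma lattice_sum_bounded : exists M : R, forall s : seq L, uniq s ->
  \sum_(x <- s) `|val x| <= M.
Proof.
have /andP[q0 q1] := hq.
pose ray (c : R) n := [seq c * q ^+ k.+1 | k <- iota 0 n].
have ray_le c n : \sum_(x <- ray c n) `|x| <= `|c| / (1 - q).
  rewrite big_map -[n in iota 0 n]subn0 -/(index_iota 0 n) big_mkord.
  apply: le_trans (geometric_sum_le hq n (normr_ge0 c)).
  apply: ler_sum => k _; rewrite normrM ler_wpM2l// gtr0_norm ?exprn_gt0//.
  by rewrite exprS ler_piMl ?exprn_ge0 ?ltW.
have ray_mono c m n : (m <= n)%N -> {subset ray c m <= ray c n}.
  move=> mn x /mapP[k]; rewrite mem_iota => km ->.
  by apply/mapP; exists k; rewrite ?mem_iota ?(leq_trans km).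
exists (`|b^-1| / (1 - q) + `|a^-1| / (1 - q)) => s us.
have [n sn] : exists n, {subset map val s <= ray b^-1 n ++ ray a^-1 n}.
  elim: s {us} => [|x s [n IH]]; first by exists 0%N.
  have [k xk] : exists k, val x \in ray b^-1 k ++ ray a^-1 k.
    have := valP x; rewrite inE /= => -[] [k _ <-]; exists k.+1;
      rewrite mem_cat; apply/orP; [left|right];
      by apply/mapP; exists k; rewrite ?mem_iota/=.
  exists (maxn n k) => y; rewrite /= inE => /orP[/eqP ->|/IH].
    by move: xk; rewrite !mem_cat => /orP[] /(ray_mono _ _ _ (leq_maxr n k)) ->;
      rewrite ?orbT.
  by rewrite !mem_cat => /orP[] /(ray_mono _ _ _ (leq_maxl n k)) ->;
    rewrite ?orbT.
rewrite -(big_map val xpredT (fun x : R => `|x|)).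
apply: (@le_trans _ _ (\sum_(x <- ray b^-1 n ++ ray a^-1 n) `|x|)).
  by apply: ler_sum_subseq => //; rewrite map_inj_uniq//; exact: val_inj.
by rewrite big_cat/= lerD.
Qed.

Lemma lattice_sum_tail (e : R) : 0 < e -> exists F : {fset L},
  forall s : seq L, uniq s -> (forall x, x \in s -> x \notin F) ->
  \sum_(x <- s) `|val x| < e.
Proof.
move=> e0; have [M HM] := lattice_sum_bounded.
pose E := [set \sum_(x <- F) `|val x| | F in [set: {fset L}]].
have supE : has_sup E.
  split; first by exists (\sum_(x <- fset0 : {fset L}) `|val x|), fset0.
  by exists M => _ [F _ <-]; apply: HM; exact: fset_uniq.
(* [F] comes within [e] of the supremum of the finite sums; adjoining [s] to [F] cannot exceed that
   supremum, so [s] contributes less than [e]. *)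
have [_ [F _ <-] HF] := sup_adherent e0 supE.
exists F => s us sF; rewrite -(ltrD2l (\sum_(x <- F) `|val x|)).
apply: (@le_lt_trans _ _ (sup E)); last by rewrite -ltrBlDr.
apply: ub_le_sup; first by case: supE.
exists (F `|` [fset x in s])%fset => //.
rewrite -big_cat/=; apply: perm_big; apply: uniq_perm; first exact: fset_uniq.
- rewrite cat_uniq fset_uniq us andbT/=.
  by apply/hasPn => x /sF.
- by move=> x; rewrite mem_cat !inE.
Qed.

(** The tail bound applied to one-point lists. *)
Lemma lattice_finite_away_from_0 (d : R) : 0 < d -> exists F : {fset L},
  forall x : L, x \notin F -> `|val x| < d.
Proof.
move=> /lattice_sum_tail[F HF]; exists F => x xF.
by have := HF [:: x]; rewrite big_seq1; apply=> // y; rewrite inE => /eqP ->.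
Qed.

End lattice_sums.

(** * Exchanging the point of least absolute value for [p] *)

Section point_avoidance.
Context (R : realType) (q a b : R).
Hypotheses (hq : 0 < q < 1) (ha : 0 < a) (hb : b < 0).
Local Notation L := (lattice q a b).

Lemma weight_fsetU1 (z : L) (Z : {fset L}) : z \notin Z ->
  weight (z |` Z)%fset =
  `|val z| * qPochhammer (a * val z) q * qPochhammer (b * val z) q *
  weight Z * \prod_(x <- Z) (val z - val x) ^+ 2.
Proof.
move=> zZ; rewrite /weight big_fsetU1//= -!mulrA; do 4 congr (_ * _).
rewrite big_fsetU1//= big_mkcond/= big_fsetU1//= ltxx mul1r.
(* The pairs with [z] as larger point are pulled out of the inner products. Together with those
   having [z] as smaller point, they give one factor for each [x] in [Z]. *)
have -> : \prod_(x <- Z)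
    \prod_(y <- (z |` Z)%fset | val x < val y) (val x - val y) ^+ 2 =
    (\prod_(x <- Z) (if val x < val z then (val z - val x) ^+ 2 else 1)) *
    \prod_(x <- Z) \prod_(y <- Z | val x < val y) (val x - val y) ^+ 2.
  rewrite -big_split/=; apply: eq_bigr => x _.
  rewrite big_mkcond/= big_fsetU1//= -big_mkcond/=.
  by case: ifP => //; rewrite -(opprB (val x)) sqrrN.
rewrite mulrA mulrC; congr (_ * _).
rewrite -big_split/=; apply: eq_big_seq => x xZ.
have /lt_total/orP[xz|zx] : val x != val z.
  by apply: contraNneq zZ => /val_inj <-.
- by rewrite xz ltNge (ltW xz) mul1r.
- by rewrite zx ltNge (ltW zx) mulr1.
Qed.

Lemma lattice_norm_gt0 (x : L) : 0 < `|val x|.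
Proof.
have [K _ /(_ x)/andP[+ _]] := factor_bounds hq ha hb.
by rewrite normr_gt0; apply: contraTneq => ->; rewrite normr0 !mul0r ltxx.
Qed.

Lemma swap_product_le (p : L) : exists2 C : R, 0 < C &
  forall (y : L) (Z : {fset L}), p \notin Z ->
  (forall x, x \in Z -> `|val y| <= `|val x|) ->
  \prod_(x <- Z) (val y - val x) ^+ 2 <=
    C * \prod_(x <- Z) (val p - val x) ^+ 2.
Proof.
have p0 := lattice_norm_gt0 p.
have [F HF] : exists F : {fset L}, forall x, x \notin F ->
    `|val x| < `|val p| / 3.
  by apply: lattice_finite_away_from_0 => //; rewrite divr_gt0.
(* The quotient bounds [(y - x)^2 / (p - x)^2], as [|y - x| <= 2|x|]. The added 1 gives [r x >= 1],
   so the product over [F] also dominates the product over any part of [F]. At [x = p] division by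
   zero gives [r p = 1], harmless since [p] is not in [Z]. *)
pose r (x : L) : R := 1 + (2 * `|val x|) ^+ 2 / (val p - val x) ^+ 2.
have r1 x : 1 <= r x by rewrite lerDl divr_ge0 ?sqr_ge0.
have r0 x : 0 < r x by rewrite (lt_le_trans ltr01).
exists (\prod_(x <- F) r x); first by apply: prodr_gt0.
move=> y Z pZ yZ.
have prod_rF : \prod_(x <- Z) (if x \in F then r x else 1) <=
    \prod_(x <- F) r x.
  rewrite -big_mkcond/= -big_filter [leRHS](bigID (mem Z))/=.
  rewrite -[leLHS]mulr1; apply: ler_pM => //.
  - by apply: prodr_ge0 => x _; rewrite ltW.
  - rewrite -[leRHS]big_filter le_eqVlt; apply/orP; left; apply/eqP.
    apply: perm_big; apply: uniq_perm; rewrite ?filter_uniq ?fset_uniq// => x.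
    by rewrite !mem_filter andbC.
  - apply: (big_ind (fun x => 1 <= x)) => // u v u1 v1.
    by rewrite -[leLHS]mulr1; apply: ler_pM; rewrite ?ler01.
apply: le_trans (ler_wpM2r _ prod_rF); last first.
  by apply: prodr_ge0 => x _; rewrite sqr_ge0.
rewrite -big_split/= big_seq [leRHS]big_seq; apply: ler_prod => x xZ.
rewrite sqr_ge0/=.
have yx : `|val y - val x| <= 2 * `|val x|.
  rewrite (le_trans (ler_normB _ _))// mulr_natl mulr2n lerD2r.
  exact: yZ.
have yx2 : (val y - val x) ^+ 2 <= (2 * `|val x|) ^+ 2.
  by rewrite -real_normK ?num_real// lerXn2r ?nnegrE// mulr_ge0.
case: ifPn => xF.
  have px : 0 < (val p - val x) ^+ 2.
    rewrite exprn_even_gt0//= subr_eq0.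
    by apply: contraNneq pZ => /val_inj ->.
  apply: (le_trans yx2); rewrite /r [leRHS]mulrDl mul1r divfK ?gt_eqF//.
  by rewrite lerDr ltW.
rewrite mul1r; apply: (le_trans yx2).
rewrite -[leRHS]real_normK ?num_real// lerXn2r ?nnegrE ?mulr_ge0//.
(* From [3|x| <= |p|] follows [2|x| <= |p| - |x| <= |p - x|]. *)
have := HF _ xF; rewrite ltr_pdivlMr// => /ltW px.
by apply: le_trans (lerB_dist _ _); lra.
Qed.

(** The one-point factor of [y] is at most [K |y|], that of [p] is the fixed number [w p], and the
    Vandermonde factors compare by [swap_product_le]; hence the constant [K * C / w p]. *)
Lemma swap_weight_le (p : L) : exists2 C : R, 0 < C &
  forall (y : L) (Z : {fset L}), p \notin Z -> y \notin Z ->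
  (forall x, x \in Z -> `|val y| <= `|val x|) ->
  weight (y |` Z)%fset <= C * `|val y| * weight (p |` Z)%fset.
Proof.
have [K K0 HK] := factor_bounds hq ha hb.
have [C C0 HC] := swap_product_le p.
set w := fun x : L =>
  `|val x| * qPochhammer (a * val x) q * qPochhammer (b * val x) q in HK.
have wp0 : 0 < w p by have /andP[] := HK p.
exists (K * C / w p); first by rewrite divr_gt0// mulr_gt0.
move=> y Z pZ yZ ymin; rewrite !weight_fsetU1// -/(w y) -/(w p).
have W0 := weight_gt0 hq ha hb Z.
have -> : forall u v : R, K * C / w p * u * (w p * weight Z * v) =
    (K * u * weight Z) * (C * v).
  by move=> u v; field; rewrite gt_eqF.
have /andP[wy0 wy] := HK y.
apply: ler_pM; last exact: HC.
- by rewrite mulr_ge0// ltW.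
- by apply: prodr_ge0 => x _; rewrite sqr_ge0.
- by rewrite ler_pM2r.
Qed.

Lemma min_norm_point (s : seq L) (x0 : L) : exists2 y, y \in x0 :: s &
  forall x, x \in x0 :: s -> `|val y| <= `|val x|.
Proof.
elim: s => [|z s [y ys ymin]].
  by exists x0; rewrite ?mem_head// => x; rewrite inE => /eqP ->.
have [yz|zy] := leP `|val y| `|val z|.
  exists y; first by move: ys; rewrite !inE => /orP[] ->; rewrite ?orbT.
  move=> x; rewrite !inE => /or3P[xx0|/eqP ->//|xs]; apply: ymin;
  by rewrite inE ?xx0 ?xs ?orbT.
exists z; first by rewrite !inE eqxx orbT.
move=> x; rewrite !inE => /or3P[xx0|/eqP ->//|xs]; apply: (le_trans (ltW zy));
by apply: ymin; rewrite inE ?xx0 ?xs ?orbT.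
Qed.

Lemma sum_weight_le_partition_function N (B : seq {fset L}) : uniq B ->
  (forall X, X \in B -> #|` X| = N) ->
  \sum_(X <- B) weight X <= fine (partition_function q a b N).
Proof.
move=> uB BN; rewrite -lee_fin fineK ?partition_function_fin_num//.
apply: esum_ge; exists [set` B].
  by split; [exact: finite_seq|move=> X /= /BN].
by rewrite -fsbig_seq//= sumEFin.
Qed.

(** The exchange bounds the sum by [C] times a double sum over pairs (removed point, new
    configuration). This factors into a tail of the sum of [|y|], below [e / C], and at most the
    partition function. *)
Lemma sum_weight_avoiding_le (p : L) (e : R) : 0 < e -> exists n : nat,
  forall N (A : seq {fset L}), (n < N)%N -> uniq A ->
  (forall X, X \in A -> #|` X| = N /\ p \notin X) ->
  \sum_(X <- A) weight X <= e * fine (partition_function q a b N).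
Proof.
move=> e0; have [C C0 HC] := swap_weight_le p.
have [F HF] := lattice_sum_tail a b hq (divr_gt0 e0 C0).
(* [p] serves only to make the list nonempty when [F] is empty. *)
have [z _ zmin] := min_norm_point F p.
have z0 : 0 < `|val z| by exact: lattice_norm_gt0.
(* [X] has a point outside [G], which is closer to 0 than every point of [F]. *)
have [G HG] := lattice_finite_away_from_0 a b hq z0.
exists #|` G| => N A GN uA AN.
(* On the empty configuration [y] takes the dummy value [p]; members of [A] are nonempty because
   [N > #|G|]. *)
have /choice[y Hy] : forall X : {fset L}, exists y, X != fset0 ->
    y \in X /\ forall x, x \in X -> `|val y| <= `|val x|.
  move=> X; have [->|/fset0Pn[x xX]] := eqVneq X fset0; first by exists p.
  have [y yX ymin] := min_norm_point X x; exists y => _; split.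
    by move: yX; rewrite inE => /orP[/eqP ->|].
  by move=> t tX; apply: ymin; rewrite inE tX orbT.
have {}Hy X : X \in A ->
    y X \in X /\ forall x, x \in X -> `|val (y X)| <= `|val x|.
  move=> /AN[XN _]; apply: Hy; rewrite -cardfs_gt0 XN.
  exact: leq_ltn_trans GN.
have yF X : X \in A -> y X \notin F.
  move=> XA; have [yX ymin] := Hy _ XA; have [XN _] := AN _ XA.
  have /fsubsetPn[x xX xG] : ~~ (X `<=` G)%fset.
    by apply: contraL GN => /fsubset_leq_card; rewrite XN leqNgt.
  apply/negP => yF; have := HG _ xG; apply/negP; rewrite -leNgt.
  by apply: (le_trans _ (ymin _ xX)); apply: zmin; rewrite inE yF orbT.
pose swap X := (p |` (X `\ y X))%fset.
have swap_card X : X \in A -> #|` swap X| = N.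
  move=> XA; have [yX _] := Hy _ XA; have [XN pX] := AN _ XA.
  by rewrite cardfsU1 !inE (negbTE pX) andbF/= -XN (cardfsD1 (y X) X) yX.
pose code X := (y X, swap X).
(* [X] is recovered from its code by deleting [p] from [swap X] and putting [y X] back. *)
have code_inj : {in A &, injective code}.
  move=> X X' XA X'A [yy ss]; have [yX _] := Hy _ XA; have [yX' _] := Hy _ X'A.
  have swapK Y : Y \in A -> Y = (y Y |` (swap Y `\ p))%fset.
    move=> YA; have [yY _] := Hy _ YA; have [_ pY] := AN _ YA.
    by rewrite fsetU1K ?fsetD1K// !inE (negbTE pY) andbF.
  by rewrite (swapK _ XA) (swapK _ X'A) yy ss.
pose ys := undup (map y A); pose B := undup (map swap A).
apply: (@le_trans _ _ (\sum_(u <- map code A) C * `|val u.1| * weight u.2)).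
  rewrite big_map big_seq [leRHS]big_seq; apply: ler_sum => X XA /=.
  have [yX ymin] := Hy _ XA; have [_ pX] := AN _ XA.
  rewrite -{1}(fsetD1K yX); apply: HC.
  - by rewrite !inE (negbTE pX) andbF.
  - by rewrite !inE eqxx.
  - by move=> x; rewrite !inE => /andP[_]; exact: ymin.
(* By injectivity the codes are distinct pairs; enlarging to all pairs in [ys] times [B] makes the
   sum a product. *)
apply: (@le_trans _ _
    (\sum_(u <- [seq (x, X) | x <- ys, X <- B]) C * `|val u.1| * weight u.2)).
  apply: ler_sum_subseq.
  - move=> u; apply: mulr_ge0; last exact: ltW (weight_gt0 hq ha hb _).
    by rewrite mulr_ge0// ltW.
  - by rewrite map_inj_in_uniq.
  - move=> _ /mapP[X XA ->]; apply: allpairs_f; rewrite mem_undup;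
    exact: map_f.
rewrite big_allpairs/=.
under eq_bigr do rewrite -mulr_sumr.
rewrite -mulr_suml -mulr_sumr; apply: ler_pM.
- by rewrite mulr_ge0 ?(ltW C0)// sumr_ge0.
- by apply: sumr_ge0 => X _; rewrite ltW// weight_gt0.
- rewrite mulrC -ler_pdivlMr// ltW//; apply: HF; first exact: undup_uniq.
  by move=> x; rewrite mem_undup => /mapP[X XA ->]; exact: yF.
- apply: sum_weight_le_partition_function; first exact: undup_uniq.
  by move=> X'; rewrite mem_undup => /mapP[X XA ->]; exact: swap_card.
Qed.

(** An [\esum] is a supremum of finite sums, and the preceding bound is uniform over these. *)
Lemma ensemble_avoiding_le (p : L) (e : R) : 0 < e ->
  \forall N \near \oo,
  (ensemble hq ha hb N [set c : configuration q a b | c p = false] <= e%:E)%E.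
Proof.
move=> e0; have [n Hn] := sum_weight_avoiding_le p e0.
exists n.+1 => // N /= nN.
have Z0 : 0 < fine (partition_function q a b N).
  have Zfin := partition_function_fin_num hq ha hb N.
  by rewrite fine_gt0// -ge0_fin_numE ?Zfin ?ltW ?partition_function_gt0.
rewrite /ensemble muleC lee_pdivrMr//; rewrite -EFinM.
apply: ge_ereal_sup => _ [A [finA AN] <-].
rewrite fsbig_finite//= sumEFin lee_fin.
apply: Hn => //; first exact: fset_uniq.
move=> X; rewrite in_fset_set// inE => /AN[XN]; rewrite /config_of /= => pX.
by split => //; rewrite pX.
Qed.
End point_avoidance.

(** * Weak convergence to a point mass *)

Lemma continuous_borel_measurable (R : realType) (T : ptopologicalType)
    (f : T -> R) :
  continuous f -> measurable_fun [set: borel T] (f : borel T -> R).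
Proof.
move=> /continuousP cf.
apply: (measurability _ (RGenOpens.measurableE R)) => _ [_ [c [d ->] <-]].
rewrite setTI; apply: sub_sigma_algebra; apply: cf; exact: interval_open.
Qed.

Section concentration.
Context (R : realType) (T : ptopologicalType).
Variables (P : nat -> probability (borel T) R) (t : T).

(* The sets that carry asymptotically all the mass form a filter, so it is
   enough to test them on a subbasis of neighborhoods. *)
Definition asymptotically_full : set_system T := [set U |
  exists V : set T, [/\ V `<=` U, measurable (V : set (borel T)) &
    forall e : R, 0 < e -> \forall N \near \oo, (P N (~` V) <= e%:E)%E]].

(** Stability under intersection is the union bound, with [e / 2] for each complement. It is applied
    to the inner measurable sets, since the members themselves need not be Borel. *)
Lemma asymptotically_full_filter : Filter asymptotically_full.
Proof.
split.
- exists setT; split => // e e0; apply: nearW => N.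
  by rewrite setCT measure0 lee_fin ltW.
- move=> U U' [V [VU mV PV]] [V' [VU' mV' PV']]; exists (V `&` V'); split.
  + exact: setISS.
  + exact: measurableI.
  + move=> e e0; have e2 : 0 < e / 2 by rewrite divr_gt0.
    have := PV _ e2; have := PV' _ e2; apply: filterS2 => N P1 P2.
    rewrite setCI (splitr e) EFinD.
    apply: (le_trans (measureU2 _ _ _)); [exact: measurableC..|].
    exact: leeD.
- move=> U U' UU' [V [VU mV PV]]; exists V; split => //.
  exact: subset_trans UU'.
Qed.

(** The integral of [|f - f t|] is split along a set [V] on which [f] is within [e / 2] of [f t]:
    off [V] the integrand is at most [K], and the mass is eventually at most [e / 2 / K]. *)
Lemma weakly_converges_dirac : asymptotically_full --> t ->
  weakly_converges P (@dirac _ (borel T) t R).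
Proof.
move=> Pt f cf bf; have mf := continuous_borel_measurable cf.
have [K K0 fK] : exists2 K : R, 0 < K & forall x, `|f x - f t| <= K.
  have [M [_ HM]] := bf.
  (* Boundedness supplies the estimate only for constants strictly above [M]; [|M| + 1] is one, and
     is positive. *)
  have fM x : `|f x| <= `|M| + 1.
    by apply: HM => //; rewrite (le_lt_trans (ler_norm M))// ltrDl.
  exists ((`|M| + 1) + (`|M| + 1)); first by rewrite addr_gt0// ltr_wpDl.
  by move=> x; rewrite (le_trans (ler_normB _ _))// lerD.
have intf N : (P N).-integrable setT (EFin \o f).
  apply: measurable_bounded_integrable => //.
  exact: le_lt_trans (probability_le1 (P N) measurableT) (ltry 1).
have -> : (\int[@dirac _ (borel T) t R]_x (f x)%:E = (f t)%:E)%E.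
  rewrite (@integral_dirac _ (borel T) t R _ measurableT).
    by rewrite diracE in_setT mul1e.
  exact/measurable_EFinP.
apply/fine_cvgP; split.
  by apply: nearW => N; exact: (integrable_fin_num measurableT (intf N)).
apply/cvgrPdist_le => e e0.
have e2 : 0 < e / 2 by rewrite divr_gt0.
have [V [VU mV PV]] : asymptotically_full [set x | `|f x - f t| <= e / 2].
  apply: Pt; have /cvgrPdist_le/(_ _ e2) := cf t.
  by apply: filterS => x /=; rewrite distrC.
have := PV _ (divr_gt0 e2 K0); apply: filterS => N PN.
rewrite /= distrC -lee_fin.
pose g (x : borel T) : R := f x - f t.
have mg : measurable_fun setT g by exact: measurable_funB.
have intg : (\int[P N]_x (g x)%:E = \int[P N]_x (f x)%:E - (f t)%:E)%E.
  rewrite (integralB measurableT (intf N)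
    (finite_measure_integrable_cst (P N) (f t) measurableT)).
  congr (_ - _)%E; rewrite (integral_cst (P N) measurableT (f t)%:E).
  by rewrite -[RHS]mule1; congr (_ * _)%E; exact: probability_setT.
have -> : (`|fine (\int[P N]_x (f x)%:E) - f t|%:E =
    `|\int[P N]_x (g x)%:E|)%E.
  by rewrite intg -{2}(fineK (integrable_fin_num measurableT (intf N))) -EFinB.
apply: (le_trans (le_abse_integral _ _ _)) => //; first exact/measurable_EFinP.
apply: (@le_trans _ _
    (\int[P N]_x ((e / 2)%:E + K%:E * (\1_(~` V) x)%:E))%E).
  apply: ge0_le_integral => //.
  - exact/measurable_EFinP/measurableT_comp.
  - apply/measurable_EFinP; apply: measurable_funD => //.
    apply: measurable_funM => //.
    apply: measurable_indic; exact: measurableC.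
  - move=> x _ /=; rewrite lee_fin indicE.
    have [xV|xV] := boolP (x \in ~` V).
      by rewrite mulr1 (le_trans (fK x))// lerDr ltW.
    rewrite mulr0 addr0; apply: VU; apply: contrapT => nV.
    by move/negP: xV; apply; rewrite inE.
have mV1 : measurable_fun [set: borel T] (fun x => (\1_(~` V) x)%:E : \bar R).
  by apply/measurable_EFinP; apply: measurable_indic; exact: measurableC.
rewrite ge0_integralD//; last 3 first.
- by move=> x _; rewrite lee_fin ltW.
- by move=> x _; rewrite -EFinM lee_fin mulr_ge0// ltW.
- exact: measurable_funeM.
rewrite (ge0_integralZl_EFin _ _ _ mV1)//; last exact: ltW.
rewrite (integral_cst (P N) measurableT (e / 2)%:E).
rewrite (integral_indic (P N) measurableT (measurableC mV)) setIT.
rewrite [X in (_ <= X%:E)%E]splitr EFinD; apply: leeD.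
  apply: le_trans (lee_wpmul2l _ (probability_le1 (P N) measurableT)) _.
    by rewrite lee_fin ltW.
  by rewrite mule1.
apply: (@le_trans _ _ (K%:E * (e / 2 / K)%:E)%E).
  by apply: lee_wpmul2l => //; rewrite lee_fin ltW.
by rewrite -EFinM lee_fin mulrC divfK// gt_eqF.
Qed.
End concentration.

(** * Concentration at the full lattice *)

Theorem theorem5p2 (R : realType) (q a b : R)
    (hq : 0 < q < 1) (ha : 0 < a) (hb : b < 0) :
  weakly_converges (fun N => ensemble hq ha hb N)
    (@dirac _ (borel (configuration q a b)) (full_config q a b) R).
Proof.
apply: weakly_converges_dirac.
set G := asymptotically_full _.
have GF : Filter G by exact: asymptotically_full_filter.
(* In the product topology, convergence of a filter is tested one coordinate [p] at a time. *)
apply/pointwise_cvgP => p U Up.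
have {}Up : U true by exact: nbhs_singleton Up.
exists [set c : configuration q a b | c p = true]; split.
- by move=> c /= ->.
(* The cylinder is open, as the preimage of a point of the discrete space [bool] under a continuous
   projection. *)
- apply: sub_sigma_algebra.
  have /continuousP cp : continuous (fun c : configuration q a b => c p).
    exact: (@proj_continuous _ (fun=> bool) p).
  by apply: (cp [set true]); exact: discrete_open.
- move=> e e0; have := ensemble_avoiding_le hq ha hb p e0.
  apply: filterS => N; congr (_ <= _)%E; congr (ensemble _ _ _ _).
  by apply/seteqP; split => c /=; case: (c p).
Qed.
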